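(* Suppose there is $\rho>0$ with $\ell_{jk}/r_{jk}=\rho$ for all $(j,k)\in\mathcal{E}$, and let $\kappa=\tan^{-1}(\rho\,\omega_0)$. Let $\{(p_k^\star,q_k^\star,v_k^\star)\}_{k\in\mathcal{V}}$ be feasible set-points, with angle set-points $\theta_{jk}^\star$ such that the power-flow equations given in the context hold. Then for every $k\in\mathcal{V}$ the matrix $$K_k=\sum_{j:(j,k)\in\mathcal{E}}w_{jk}\left(I_2-\frac{v_j^\star}{v_k^\star}R(\theta_{jk}^\star)\right)$$ satisfies $$K_k=\frac{1}{v_k^{\star2}}\,R(\kappa)\begin{bmatrix}p_k^\star&q_k^\star\\-q_k^\star&p_k^\star\end{bmatrix}.$$
   Context: $\mathcal{G}=(\mathcal{V},\mathcal{E},\{w_{jk}\})$ is a simple connected undirected graph on $\mathcal{V}=\{1,\dots,N\}$ modelling a power network. Each edge (line) $(j,k)\in\mathcal{E}$ has resistance $r_{jk}=r_{kj}>0$ and inductance $\ell_{jk}=\ell_{kj}>0$, $\omega_0\ge0$ is the nominal frequency, and the edge weights are $w_{jk}=1/\sqrt{r_{jk}^2+\omega_0^2\ell_{jk}^2}$. $R(\theta)=\begin{bmatrix}\cos\theta&-\sin\theta\\ \sin\theta&\cos\theta\end{bmatrix}$. Angle set-points have the form $\theta_{jk}^\star=\theta_{j1}^\star-\theta_{k1}^\star$. Feasibility: set-points $p_k^\star,q_k^\star\in\mathbb{R}$, $v_k^\star>0$ ($k\in\mathcal{V}$) are feasible if there exist angle set-points $\theta_{jk}^\star$ such that for all $k\in\mathcal{V}$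 the power-flow equations hold: $$p_k^\star=\sum_{j:(j,k)\in\mathcal{E}}\frac{v_k^{\star2}r_{jk}-v_k^\star v_j^\star\big(r_{jk}\cos\theta_{jk}^\star+\omega_0\ell_{jk}\sin\theta_{jk}^\star\big)}{r_{jk}^2+\omega_0^2\ell_{jk}^2},$$ $$q_k^\star=\sum_{j:(j,k)\in\mathcal{E}}\frac{v_k^{\star2}\omega_0\ell_{jk}-v_k^\star v_j^\star\big(\omega_0\ell_{jk}\cos\theta_{jk}^\star-r_{jk}\sin\theta_{jk}^\star\big)}{r_{jk}^2+\omega_0^2\ell_{jk}^2}.$$ *)

(* Defs.v *)
From HB Require Import structures.
From mathcomp Require Import all_boot all_order all_algebra.
From mathcomp Require Import reals trigo.

Set Implicit Arguments.
Unset Strict Implicit.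
Unset Printing Implicit Defensive.

Import Order.TTheory GRing.Theory Num.Theory.

Local Open Scope ring_scope.

(* The edge set is {(j, k) | E j k}. *)
Definition simple_connected_graph (N : nat) (E : rel 'I_N) : Prop :=
  [/\ symmetric E, irreflexive E & forall j k, connect E j k].

Definition mx2 (R : realType) (a b c d : R) : 'M[R]_2 :=
  \matrix_(i < 2, j < 2) nth 0 (nth [::] [:: [:: a; b]; [:: c; d]] i) j.

Definition rotation (R : realType) (t : R) : 'M[R]_2 :=
  mx2 (cos t) (- sin t)
      (sin t) (cos t).

Section PowerNetwork.
(* Resistances r and inductances l are functions on ordered pairs of nodes;
   only their values on edges are ever used. *)
Context (R : realType) (N : nat) (E : rel 'I_N) (r l : 'I_N -> 'I_N -> R).
Context (omega0 : R).

Definition line_parameters : Prop :=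
  forall j k, E j k ->
    [/\ 0 < r j k, 0 < l j k, r j k = r k j & l j k = l k j].

Definition weight (j k : 'I_N) : R :=
  (Num.sqrt (r j k ^+ 2 + omega0 ^+ 2 * l j k ^+ 2))^-1.

(* theta j k is the relative angle from node k to node j; node1 is the
   reference node, so that the condition forces theta node1 node1 = 0. *)
Definition angle_setpoints (node1 : 'I_N) (theta : 'I_N -> 'I_N -> R) : Prop :=
  forall j k, theta j k = theta j node1 - theta k node1.

Definition power_flow (p q v : 'I_N -> R) (theta : 'I_N -> 'I_N -> R) : Prop :=
  forall k,
    p k = \sum_(j | E j k)
      (v k ^+ 2 * r j k
         - v k * v j * (r j k * cos (theta j k)
                        + omega0 * l j k * sin (theta j k)))
      / (r j k ^+ 2 + omega0 ^+ 2 * l j k ^+ 2)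
    /\
    q k = \sum_(j | E j k)
      (v k ^+ 2 * (omega0 * l j k)
         - v k * v j * (omega0 * l j k * cos (theta j k)
                        - r j k * sin (theta j k)))
      / (r j k ^+ 2 + omega0 ^+ 2 * l j k ^+ 2).

Definition feasible (node1 : 'I_N) (p q v : 'I_N -> R) : Prop :=
  (forall k, 0 < v k) /\
  exists theta, angle_setpoints node1 theta /\ power_flow p q v theta.

Definition Kmx (v : 'I_N -> R) (theta : 'I_N -> 'I_N -> R) (k : 'I_N)
    : 'M[R]_2 :=
  \sum_(j | E j k) weight j k *: (1%:M - (v j / v k) *: rotation (theta j k)).

End PowerNetwork.

(* Main.v *)
(* Constant l/r makes every line impedance r + i omega0 l a positive multiple
   of e^(i kappa), with modulus r / cos kappa.  Rotating the complex power
   injected into a line by kappa therefore removes the dependence on the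
   impedance angle, and only the weight w = cos kappa / r remains. *)
Require Import Defs.
From HB Require Import structures.
From mathcomp Require Import all_boot all_order all_algebra.
From mathcomp Require Import reals trigo.
From mathcomp Require Import ring.

Import Order.TTheory GRing.Theory Num.Theory.

Local Open Scope ring_scope.

Lemma mx2_sum (R : realType) (I : finType) (P : pred I) (a b c d : I -> R) :
  mx2 (\sum_(i | P i) a i) (\sum_(i | P i) b i)
      (\sum_(i | P i) c i) (\sum_(i | P i) d i) =
  \sum_(i | P i) mx2 (a i) (b i) (c i) (d i).
Proof.
apply/matrixP => m n; rewrite summxE !mxE.
by case: m n => [[|[|//]] ?] [[|[|//]] ?] /=; apply: eq_bigr => i _; rewrite mxE.
Qed.

Lemma scale_mx2 (R : realType) (x a b c d : R) :
  x *: mx2 a b c d = mx2 (x * a) (x * b) (x * c) (x * d).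
Proof. by apply/matrixP => -[[|[|//]] ?] [[|[|//]] ?]; rewrite !mxE. Qed.

Lemma mul_mx2 (R : realType) (a b c d a' b' c' d' : R) :
  mx2 a b c d *m mx2 a' b' c' d' =
  mx2 (a * a' + b * c') (a * b' + b * d') (c * a' + d * c') (c * b' + d * d').
Proof.
by apply/matrixP => -[[|[|//]] ?] [[|[|//]] ?];
  rewrite !mxE big_ord_recl big_ord1 !mxE.
Qed.

Lemma scalar_sub_mx2 (R : realType) (a b c d : R) :
  1%:M - mx2 a b c d = mx2 (1 - a) (- b) (- c) (1 - d).
Proof.
by apply/matrixP => -[[|[|//]] ?] [[|[|//]] ?]; rewrite !mxE //= sub0r.
Qed.

Lemma cos_atan_gt0 (R : realType) (t : R) : 0 < cos (atan t).
Proof. by rewrite cos_gt0_pihalf // atan_gtNpi2 atan_ltpi2. Qed.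

(** This is [tan (atan t) = t] cleared of its denominator, which is nonzero because [atan] stays
    strictly between -pi/2 and pi/2. *)
Lemma sin_atan_cos (R : realType) (t : R) : sin (atan t) = t * cos (atan t).
Proof.
by rewrite -[X in X * _](atanK t) /tan divfK // gt_eqF // cos_atan_gt0.
Qed.

Lemma impedance_sqr (R : realType) (r l omega0 rho : R) :
  0 < r -> l / r = rho ->
  r ^+ 2 + omega0 ^+ 2 * l ^+ 2 = (r / cos (atan (rho * omega0))) ^+ 2.
Proof.
move=> r0 lr; have r_neq0 : r != 0 by rewrite gt_eqF.
have c0 : cos (atan (rho * omega0)) != 0 by rewrite gt_eqF // cos_atan_gt0.
have := cos2Dsin2 (atan (rho * omega0)); rewrite sin_atan_cos.
move: c0; set c := cos _ => c0 cs1.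
have -> : l = rho * r by rewrite -lr divfK.
(* The numerator [r ^+ 2] is multiplied by 1, written as [c ^+ 2 + (rho * omega0 * c) ^+ 2], so that
   [c ^+ 2] cancels. *)
rewrite expr_div_n -[X in X / _]mulr1 -cs1; field; exact: c0.
Qed.

(** Identify [mx2 a (- b) b a] with a + ib and put z = r + i omega0 l. Then P - iQ = v^2 (1 - (u/v)
    e^(it)) / z, and multiplying by e^(i kappa) = z/|z| replaces 1/z by 1/|z|, the weight of the
    line. *)
Lemma line_contribution (R : realType) (r l omega0 rho u v t : R)
    (kappa := atan (rho * omega0)) (z2 := r ^+ 2 + omega0 ^+ 2 * l ^+ 2)
    (P := (v ^+ 2 * r - v * u * (r * cos t + omega0 * l * sin t)) / z2)
    (Q := (v ^+ 2 * (omega0 * l)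
             - v * u * (omega0 * l * cos t - r * sin t)) / z2) :
  0 < r -> l / r = rho -> 0 < v ->
  (Num.sqrt z2)^-1 *: (1%:M - (u / v) *: rotation t) =
  (v ^+ 2)^-1 *: (rotation kappa *m mx2 P Q (- Q) P).
Proof.
move=> r0 lr v0; have rN0 : r != 0 by rewrite gt_eqF.
have vN0 : v != 0 by rewrite gt_eqF.
have c0 : 0 < cos kappa := cos_atan_gt0 R _.
have cN0 : cos kappa != 0 by rewrite gt_eqF.
have z2E : z2 = (r / cos kappa) ^+ 2 by exact: impedance_sqr.
have weightE : (Num.sqrt z2)^-1 = cos kappa / r.
  by rewrite z2E sqrtr_sqr gtr0_norm ?divr_gt0 // invf_div.
have sE : sin kappa = rho * omega0 * cos kappa := sin_atan_cos R _.
(* The reactance is r tan kappa; this eliminates [l], [omega0] and [rho] from the power-flow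
   terms. *)
have lE : omega0 * l = r * (sin kappa / cos kappa).
  by rewrite sE mulfK // -lr; field.
have s2E : sin kappa ^+ 2 = 1 - cos kappa ^+ 2 := sin2cos2 _.
rewrite weightE /rotation scale_mx2 scalar_sub_mx2 scale_mx2 mul_mx2 scale_mx2.
rewrite /P /Q lE z2E.
move: s2E cN0; set c := cos kappa; set s := sin kappa => s2E cN0.
(* In each entry the mixed products of [s] and [c] cancel, and the squares combine through [s2E],
   the only relation needed between the two. *)
by congr mx2; field: s2E; rewrite ?vN0 ?rN0 ?cN0.
Qed.

Theorem proposition3 (R : realType) (N : nat) (hN : (0 < N)%N)
  (E : rel 'I_N) (hE : simple_connected_graph E)
  (r l : 'I_N -> 'I_N -> R) (hrl : line_parameters E r l)
  (omega0 : R) (homega0 : 0 <= omega0)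
  (rho : R) (hrho : 0 < rho)
  (hratio : forall j k, E j k -> l j k / r j k = rho)
  (kappa : R) (hkappa : kappa = atan (rho * omega0))
  (p q v : 'I_N -> R) (hfeas : feasible E r l omega0 (Ordinal hN) p q v)
  (theta : 'I_N -> 'I_N -> R)
  (htheta : angle_setpoints (Ordinal hN) theta)
  (hflow : power_flow E r l omega0 p q v theta) :
  forall k : 'I_N,
    Kmx E r l omega0 v theta k =
      (v k ^+ 2)^-1 *: (rotation kappa *m mx2 (p k) (q k) (- q k) (p k)).
Proof.
move=> k; have [v_gt0 _] := hfeas; have [-> ->] := hflow k.
(* Since [rho] is common to all lines, so is [rotation kappa]; it moves inside the sum over the
   neighbours of [k], and the claim splits line by line. *)
rewrite -sumrN mx2_sum mulmx_sumr scaler_sumr hkappa.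
apply: eq_bigr => j jk; have [r0 _ _ _] := hrl j k jk.
exact: line_contribution (hratio j k jk) (v_gt0 k).
Qed.
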